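(* Every graph $G$ satisfies $\mu_{\mathcal{B}}(G)\leqslant \operatorname{col}(G)$, where $\mathcal{B}$ is the family of bi-polar strategies and $\operatorname{col}(G)$ is the coloring number of $G$.
   Context: Let $G$ be a (finite, loopless) graph with $n$ vertices and let $\Gamma_K$ be a set of $K$ colors. A strategy for a vertex $v$ is a function $F_v$ from the set of all colorings of $V(G)$ by $\Gamma_K$ to $\Gamma_K$ whose value depends only on the colors of the neighbors of $v$ in $G$. A system of strategies (one for each vertex) is winning if for every coloring $x$ of the vertices by $\Gamma_K$ (not necessarily proper) there is at least one vertex $v$ with $F_v(x)=x_v$. Given a linear order $v_1,\dots,v_n$ of the vertices, identify colorings with elements $(x_1,\dots,x_n)\in\Gamma_K^n$ ($x_j$ being the color of $v_j$) and write $F_i=F_{v_i}$. For a partial coloring $(x_1,\dots,x_j)\in\Gamma_K^j$, let $F_i(\{(x_1,\dots,x_j)\}\times\Gamma_K^{n-j})$ denote the set of values of $F_i$ on all colorings extending it. The strategy $F_i$ is bi-polar with respect to the order if for all $j\geqslant i$ and all partial colorings $(x_1,\dots,x_{j-1})\in\Gamma_K^{j-1}$ the following holds: for all $x_j\in\Gamma_K$ the set $F_i(\{(x_1,\dots,x_{j-1},x_j)\}\times\Gamma_K^{n-j})$ is either equal to $\Gamma_K$ or is a singleton; moreover, for any $y\in\Gamma_K$ there is at most one $x_j\in\Gamma_K$ such that $F_i(\{(x_1,\dots,x_{j-1},x_j)\}\times\Gamma_K^{n-j})=\{y\}$. A strategy is bi-polar if it is bi-polar with respect to all linear orders of the vertices.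 The number $\mu_{\mathcal{B}}(G)$ is the maximum size $K$ of the color set for which there is a winning system of strategies on $G$ consisting only of strategies from $\mathcal{B}$, the family of bi-polar strategies. The coloring number $\operatorname{col}(G)$ is the least integer $k$ for which there is a linear order of the vertices of $G$ such that each vertex has at most $k-1$ neighbors appearing earlier in the order. *)

(* Defs.v *)
From mathcomp Require Import all_boot.

Set Implicit Arguments.
Unset Strict Implicit.
Unset Printing Implicit Defensive.

(* A graph is a symmetric irreflexive [e : rel T] on a
   finType [T]; the color set of size K is ['I_K]. *)

Definition coloring (T : finType) (K : nat) := {ffun T -> 'I_K}.

Definition strategy (T : finType) (K : nat) := {ffun coloring T K -> 'I_K}.

Definition local (T : finType) (e : rel T) (K : nat) (v : T)
    (f : strategy T K) : bool :=
  [forall x : coloring T K, forall y : coloring T K,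
     [forall (u | e v u), x u == y u] ==> (f x == f y)].

Definition winning (T : finType) (K : nat)
    (F : {ffun T -> strategy T K}) : bool :=
  [forall x : coloring T K, exists v : T, F v x == x v].

(* [B K v f]: the strategy [f] for the vertex [v], with K colors, is in B. *)
Definition family (T : finType) := forall K : nat, T -> strategy T K -> bool.

Definition winnable (T : finType) (e : rel T) (B : family T) (K : nat) : bool :=
  [exists F : {ffun T -> strategy T K},
     [forall v, local e v (F v) && B K v (F v)] && winning F].

(* The range [K <= #|T|] loses nothing, by [winnable_leq] below.  On the null
   graph no system of strategies is winning, and the value is 0. *)
Definition mu (T : finType) (e : rel T) (B : family T) : nat :=
  \max_(K < #|T|.+1 | winnable e B K) K.

(* A linear order of the vertices is a duplicate-free [o : #|T|.-tuple T]; the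
   rank of [v], counted from 0, is [index v o].  [values o f s] is the set of
   values of [f] on the colorings giving the colors listed in [s] to the first
   [size s] vertices. *)
Definition values (T : finType) (K : nat) (o : seq T) (f : strategy T K)
    (s : seq 'I_K) : {set 'I_K} :=
  [set f x | x : coloring T K & prefix s [seq x u | u <- o]].

(* Ranks start at 0, so [x : j.-tuple 'I_K] colors the vertices preceding the
   one of rank [j], and [rcons x a] also gives the latter the color [a]. *)
Definition bipolar_wrt (T : finType) (K : nat) (o : seq T) (v : T)
    (f : strategy T K) : bool :=
  [forall j : 'I_#|T|, (index v o <= j) ==>
     [forall x : j.-tuple 'I_K,
        [forall a : 'I_K, (values o f (rcons x a) == setT)
                       || (#|values o f (rcons x a)| == 1)] &&
        [forall y : 'I_K,
           #|[set a : 'I_K | values o f (rcons x a) == [set y]]| <= 1]]].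

Definition bipolar (T : finType) : family T := fun K v f =>
  [forall o : #|T|.-tuple T, uniq o ==> bipolar_wrt o v f].

(* Read literally, the uniqueness clause of [bipolar] fails for every local
   strategy when K >= 2 (see [bipolar_degenerate]): once the colors seen so far
   determine the value of [f], it is the same for all choices of the next color.
   In the following larger family (see [bipolar_open]) the clause applies only
   as long as the value is not yet determined; it contains, for instance, the
   strategies that are linear over a prime field with nonzero coefficients on
   the neighbors. *)
Definition open_bipolar_wrt (T : finType) (K : nat) (o : seq T) (v : T)
    (f : strategy T K) : bool :=
  [forall j : 'I_#|T|, (index v o <= j) ==>
     [forall x : j.-tuple 'I_K,
        [forall a : 'I_K, (values o f (rcons x a) == setT)
                       || (#|values o f (rcons x a)| == 1)] &&
        ((#|values o f x| != 1) ==>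
         [forall y : 'I_K,
            #|[set a : 'I_K | values o f (rcons x a) == [set y]]| <= 1])]].

Definition open_bipolar (T : finType) : family T := fun K v f =>
  [forall o : #|T|.-tuple T, uniq o ==> open_bipolar_wrt o v f].

(* "At most k - 1 earlier neighbors" is written with [<], so that it is correct
   for k = 0; the coloring number of the null graph is 0. *)
Definition col_order (T : finType) (e : rel T) (k : nat) : bool :=
  [exists o : #|T|.-tuple T, uniq o &&
     [forall v, #|[set u | e v u & index u o < index v o]| < k]].

Lemma ex_col_order (T : finType) (e : rel T) : exists k, col_order e k.
Proof.
exists #|T|.+1; apply/existsP; exists (enum_tuple T); rewrite enum_uniq /=.
by apply/forallP=> v; rewrite ltnS max_card.
Qed.

Definition col (T : finType) (e : rel T) : nat := ex_minn (ex_col_order e).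

Lemma winnable_leq (T : finType) (e : rel T) (B : family T) (K : nat) :
  irreflexive e -> winnable e B K -> K <= #|T|.
Proof.
move=> irr /existsP[F /andP[/forallP locB /forallP win]].
case: (posnP K) => [->//|K_gt0].
pose A v := [set x : coloring T K | F v x == x v].
have cA v : K * #|A v| <= K ^ #|T|.
  pose h (p : 'I_K * coloring T K) : coloring T K :=
    [ffun u => if u == v then p.1 else p.2 u].
  have hinj : {in setX [set: 'I_K] (A v) &, injective h}.
    move=> [a x] [b y]; rewrite !inE /= => /eqP Fx /eqP Fy eqh.
    have hE u : h (a, x) u = h (b, y) u by rewrite eqh.
    have := hE v; rewrite !ffunE eqxx /= => ->.
    have xy u : u != v -> x u = y u.
      by move=> uv; have := hE u; rewrite !ffunE (negPf uv).
    congr (_, _); apply/ffunP=> u; case: (eqVneq u v) => [->|/xy//].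
    rewrite -Fx -Fy; have /andP[/forallP/(_ x)/forallP/(_ y)/implyP H _] := locB v.
    apply/eqP/H; apply/forallP=> w; apply/implyP=> vw; apply/eqP/xy.
    by apply: contraTneq vw => ->; rewrite irr.
  have := max_card (h @: setX [set: 'I_K] (A v)).
  by rewrite card_in_imset // cardsX cardsT card_ord card_ffun card_ord.
have cov : K ^ #|T| <= \sum_v #|A v|.
  rewrite -[X in X ^ _]card_ord -card_ffun -cardsT.
  have -> : [set: coloring T K] = \bigcup_v A v.
    apply/setP=> x; rewrite inE; apply/esym/bigcupP.
    by have /existsP[v Fv] := win x; exists v => //; rewrite inE.
  elim/big_rec2: _ => [|v n U _ le]; first by rewrite cards0.
  by apply: leq_trans (leq_card_setU _ _) _; rewrite leq_add2l.
have: K * K ^ #|T| <= #|T| * K ^ #|T|.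
  apply: leq_trans (leq_mul (leqnn K) cov) _; rewrite big_distrr /= -sum_nat_const.
  exact: leq_sum.
by rewrite leq_pmul2r // expn_gt0 K_gt0.
Qed.

Lemma mu_max (T : finType) (e : rel T) (B : family T) (K : nat) :
  irreflexive e -> winnable e B K -> K <= mu e B.
Proof.
move=> irr wK; have ltK : K < #|T|.+1 by rewrite ltnS (winnable_leq irr wK).
by rewrite /mu (bigD1 (Ordinal ltK)) //= leq_maxl.
Qed.

Lemma mu_winnable (T : finType) (e : rel T) (B : family T) :
  0 < mu e B -> winnable e B (mu e B).
Proof.
rewrite /mu; case: (pickP (fun K : 'I_#|T|.+1 => winnable e B K)) => [K wK _|no].
  have gt0 : 0 < #|[pred K : 'I_#|T|.+1 | winnable e B K]|.
    by apply/card_gt0P; exists K.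
  by have [M wM ->] := eq_bigmax_cond (@nat_of_ord _) gt0.
by rewrite big_pred0.
Qed.

Lemma bipolar_open (T : finType) (K : nat) (v : T) (f : strategy T K) :
  bipolar v f -> open_bipolar v f.
Proof.
move=> /forallP H; apply/forallP=> o; apply/implyP=> uo.
have /forallP Ho := implyP (H o) uo.
apply/forallP=> j; apply/implyP=> ij; have /forallP Hj := implyP (Ho j) ij.
apply/forallP=> x; have /andP[-> Hx] := Hj x.
exact/implyP.
Qed.

Lemma bipolar_degenerate (T : finType) (e : rel T) (K : nat) (v : T)
    (f : strategy T K) :
  irreflexive e -> local e v f -> bipolar v f -> K <= 1.
Proof.
move=> irr /forallP loc /forallP bip; case: K f loc bip => // K f loc bip.
pose s := rem v (enum T).
have vT : v \in enum T by rewrite mem_enum.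
have szs : size s = #|T|.-1 by rewrite size_rem // -cardE.
have T_gt0 : 0 < #|T| by apply/card_gt0P; exists v.
have vs : v \notin s by rewrite mem_rem_uniqF ?enum_uniq.
have szo : size (rcons s v) == #|T| by rewrite size_rcons szs prednK.
have uo : uniq (rcons s v) by rewrite rcons_uniq vs rem_uniq ?enum_uniq.
have iv : index v (rcons s v) = #|T|.-1.
  by rewrite -cats1 index_cat (negPf vs) /= eqxx addn0 szs.
have ltj : #|T|.-1 < #|T| by rewrite prednK.
have /forallP/(_ (Ordinal ltj)) := implyP (bip (Tuple szo)) uo.
rewrite /= iv leqnn /= => /forallP/(_ [tuple of nseq _ ord0])/andP[_ /forallP].
pose c (a : 'I_K.+1) : coloring T K.+1 := [ffun u => if u == v then a else ord0].
have vals a : values (rcons s v) f (rcons (nseq #|T|.-1 ord0) a) = [set f (c a)].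
  have mapE (x : coloring T K.+1) :
      prefix (rcons (nseq #|T|.-1 ord0) a) [seq x u | u <- rcons s v] = (x == c a).
    apply/idP/eqP => [|->].
      rewrite prefixE size_rcons size_nseq take_oversize; last first.
        by rewrite size_map size_rcons szs.
      rewrite map_rcons eqseq_rcons => /andP[/eqP xs /eqP xv].
      apply/ffunP=> u; rewrite ffunE; case: eqVneq => [->//|uv].
      have us : u \in s by rewrite mem_rem_uniq ?enum_uniq // !inE uv mem_enum.
      have : x u \in [seq x u | u <- s] by rewrite map_f.
      by rewrite xs mem_nseq => /andP[_ /eqP].
    rewrite prefixE size_rcons size_nseq take_oversize; last first.
      by rewrite size_map size_rcons szs.
    rewrite map_rcons eqseq_rcons ffunE !eqxx andbT -szs -(size_map (c a)).
    apply/eqP/all_pred1P/allP => _ /mapP[u us ->]; rewrite /= ffunE.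
    by case: (eqVneq u v) us vs => // -> ->.
  apply/setP=> y; rewrite inE; apply/imsetP/eqP => [[x]|->].
    by rewrite inE mapE => /eqP-> ->.
  by exists (c a); rewrite // inE mapE.
move/(_ (f (c ord0))); apply: leq_trans.
rewrite -[X in X <= _]card_ord -cardsT; apply/subset_leq_card/subsetP => a _.
rewrite inE /= vals; apply/eqP; congr [set _].
have /forallP/(_ (c ord0))/implyP H := loc (c a); apply/eqP/H.
apply/forallP=> u; apply/implyP=> evu; rewrite !ffunE.
by case: (eqVneq u v) evu => // ->; rewrite irr.
Qed.

(* Main.v *)
Require Import Defs.
From mathcomp Require Import all_boot.

Set Implicit Arguments.
Unset Strict Implicit.
Unset Printing Implicit Defensive.

(** Color the vertices greedily along an order witnessing [col e], so that
    after each step no already colored vertex [v] has its guess forced to be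
    its own color.  When [w] is colored, an earlier vertex forbids at most one
    color, and none unless it is a neighbor of [w]; the guess at [w] itself does
    not depend on the color of [w], hence also forbids at most one color.  So at
    most [col e] colors are forbidden, and with more colors every system of
    open bi-polar strategies is defeated. *)

Definition recolor (T : finType) (K : nat) (x : coloring T K) (w : T)
    (a : 'I_K) : coloring T K :=
  [ffun u => if u == w then a else x u].

(** This turns one more greedy choice into an [rcons] on the list of colors: [w] does not occur
    among the vertices preceding it, so their colors stay. *)
Lemma take_recolor (T : finType) (K : nat) (o : seq T) (x : coloring T K)
    (w : T) (a : 'I_K) :
  uniq o -> w \in o ->
  take (index w o).+1 [seq recolor x w a u | u <- o] =
  rcons (take (index w o) [seq x u | u <- o]) a.
Proof.
move=> uo wo; have lt_w : index w o < size o by rewrite index_mem.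
rewrite (take_nth a) ?size_map // (nth_map w) // nth_index // ffunE eqxx.
congr rcons; rewrite -!map_take; apply/eq_in_map => u.
rewrite ffunE; case: eqVneq => // ->.
by rewrite in_take // ltnn.
Qed.

Lemma values_rcons_sub (T : finType) (K : nat) (o : seq T) (f : strategy T K)
    (s : seq 'I_K) (a : 'I_K) :
  values o f (rcons s a) \subset values o f s.
Proof.
apply/subsetP=> y /imsetP[x]; rewrite inE => sax ->.
by apply: imset_f; rewrite inE (prefix_trans (prefix_rcons _ _) sax).
Qed.

(** Any coloring extending [s] can be recolored at [w] with [a]; since [v] does not see [w], the
    value of [f] survives. *)
Lemma values_rcons_local (T : finType) (e : rel T) (K : nat) (o : seq T)
    (v w : T) (f : strategy T K) (s : seq 'I_K) (a : 'I_K) :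
  uniq o -> w \in o -> size s = index w o -> local e v f -> ~~ e v w ->
  values o f (rcons s a) = values o f s.
Proof.
move=> uo wo sz_s /forallP loc evw; apply/eqP.
rewrite eqEsubset values_rcons_sub; apply/subsetP=> y /imsetP[x].
rewrite inE prefixE sz_s => /eqP sx ->; apply/imsetP; exists (recolor x w a).
  by rewrite inE prefixE size_rcons sz_s take_recolor // sx.
have /forallP/(_ (recolor x w a))/implyP H := loc x; apply/eqP/H.
apply/forallP=> u; apply/implyP=> evu; rewrite ffunE.
by case: (eqVneq u w) evu => // ->; rewrite (negPf evw).
Qed.

(** If the value is already determined, it is not [y], and further colors only shrink the set of
    values, so no [a] can force [y]. Otherwise the uniqueness clause applies. *)
Lemma open_bipolar_forced (T : finType) (K : nat) (o : seq T) (v w : T)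
    (f : strategy T K) (s : seq 'I_K) (y : 'I_K) :
  uniq o -> size o = #|T| -> w \in o -> size s = index w o ->
  index v o <= index w o -> open_bipolar v f -> values o f s != [set y] ->
  #|[set a | values o f (rcons s a) == [set y]]| <= 1.
Proof.
move=> uo sz_o wo sz_s vw /forallP bip vals_s.
have lt_w : index w o < #|T| by rewrite -sz_o index_mem.
have szo : size o == #|T| by rewrite sz_o.
have szs : size s == index w o by rewrite sz_s.
have /forallP/(_ (Ordinal lt_w)) := implyP (bip (Tuple szo)) uo.
rewrite vw /= => /forallP/(_ (Tuple szs))/andP[_ /implyP/= undet].
case: (boolP (#|values o f s| == 1)) => [card1|/undet/forallP//].
suff -> : [set a | values o f (rcons s a) == [set y]] = set0 by rewrite cards0.
apply/setP=> a; rewrite !inE.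
apply: contraNF vals_s => /eqP valsE; rewrite eq_sym eqEcard (eqP card1) cards1.
by rewrite -valsE values_rcons_sub.
Qed.

Lemma greedy_step (T : finType) (e : rel T) (K : nat) (o : seq T)
    (F : {ffun T -> strategy T K}) (x : coloring T K) (w : T) :
  symmetric e -> irreflexive e -> uniq o -> size o = #|T| -> w \in o ->
  (forall v, local e v (F v)) -> (forall v, open_bipolar v (F v)) ->
  #|[set u | e w u & index u o < index w o]|.+1 < K ->
  (forall v, index v o < index w o ->
     values o (F v) (take (index w o) [seq x u | u <- o]) != [set x v]) ->
  exists a, forall v, index v o <= index w o ->
    values o (F v) (rcons (take (index w o) [seq x u | u <- o]) a)
      != [set recolor x w a v].
Proof.
move=> e_sym e_irr uo sz_o wo loc bip ltK inv.
set s := take _ _ in inv *.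
have sz_s : size s = index w o by rewrite size_takel // size_map index_size.
pose N := [set u | e w u & index u o < index w o].
pose bad u := [set a | values o (F u) (rcons s a) == [set x u]].
pose badw := [set a | values o (F w) s == [set a]].
have bad1 : #|badw| <= 1.
  apply/card_le1_eqP => a b; rewrite !inE => /eqP-> /eqP ab.
  by apply/esym/set1P; rewrite -ab set11.
(* One color for [w] itself plus one for each of its earlier neighbors. *)
have few : #|badw :|: \bigcup_(u in N) bad u| < K.
  apply: leq_ltn_trans (leq_card_setU _ _) _; apply: leq_ltn_trans ltK.
  rewrite -add1n leq_add // -[X in _ <= X]sum1_card.
  elim/big_rec2: _ => [|u n U]; first by rewrite cards0.
  rewrite inE => /andP[_ ltu] leU.
  apply: leq_trans (leq_card_setU _ _) (leq_add _ leU).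
  by apply: (@open_bipolar_forced T K o u w) => //; [exact: ltnW | exact: inv].
have /set0Pn[a] : ~: (badw :|: \bigcup_(u in N) bad u) != set0.
  by rewrite -card_gt0 cardsCs setCK card_ord subn_gt0.
rewrite !inE negb_or => /andP[aw aN]; exists a => v le_v; rewrite ffunE.
case: (eqVneq v w) le_v => [->|vw] le_v.
  by rewrite (values_rcons_local _ uo wo sz_s (loc w)) ?e_irr.
(* [v] is not assumed to lie in [o]; having the same rank as [w] would put it there and make it
   equal to [w]. *)
have lt_v : index v o < index w o.
  rewrite ltn_neqAle le_v andbT; apply: contra vw => /eqP eq_i.
  by rewrite -(nth_index w wo) -eq_i nth_index // -index_mem eq_i index_mem.
case: (boolP (e v w)) => evw; last first.
  (* For a non-neighbor of [w] the set of values is unchanged, and the invariant carries over. *)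
  by rewrite (values_rcons_local _ uo wo sz_s (loc v)) ?inv.
by apply: contra aN => av; apply/bigcupP; exists v; rewrite inE // e_sym evw.
Qed.

Lemma open_bipolar_not_winning (T : finType) (e : rel T) (K k : nat)
    (F : {ffun T -> strategy T K}) :
  symmetric e -> irreflexive e -> col_order e k -> k < K ->
  (forall v, local e v (F v)) -> (forall v, open_bipolar v (F v)) ->
  ~~ winning F.
Proof.
move=> e_sym e_irr /existsP[o /andP[uo /forallP degk]] ltK loc bip.
have sz_o : size o = #|T| by rewrite size_tuple.
have all_o u : u \in o.
  have [||_ ->] := @uniq_min_size _ o (enum T) uo; rewrite ?mem_enum //.
    by move=> v _; rewrite mem_enum.
  by rewrite sz_o -cardE.
(* Only the colors of the first [j] vertices matter here; those [x] gives to later vertices are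
   placeholders. *)
have greedy j : j <= #|T| -> exists x : coloring T K, forall v,
    index v o < j -> values o (F v) (take j [seq x u | u <- o]) != [set x v].
  elim: j => [_|j IHj lt_j].
    (* The condition is vacuous, but some color is needed: [k < K] makes 0 one. *)
    by exists [ffun => Ordinal (leq_ltn_trans (leq0n k) ltK)] => v.
  have [x inv] := IHj (ltnW lt_j).
  have [w ij] : exists w, index w o = j.
    (* The head of [o] serves as the default for [nth]. *)
    rewrite -sz_o in lt_j; case: (tval o) uo lt_j => // u0 o' uo lt_j.
    by exists (nth u0 (u0 :: o') j); exact: index_uniq.
  rewrite -ij in inv *.
  have ltdeg := leq_ltn_trans (degk w) ltK.
  have [a aP] := greedy_step e_sym e_irr uo sz_o (all_o w) loc bip ltdeg inv.
  exists (recolor x w a) => v; rewrite ltnS take_recolor //; exact: aP.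
have [x inv] := greedy _ (leqnn _).
apply/negP=> /forallP/(_ x)/existsP[v /eqP Fv].
have lt_v : index v o < #|T| by rewrite -[X in _ < X]sz_o index_mem.
(* With every vertex colored, [x] is the only extension, so the set of values is the singleton of
   [F v x], which is [x v]. *)
have /eqP[] := inv v lt_v; rewrite take_oversize ?size_map ?sz_o //.
apply/setP=> y; rewrite inE; apply/imsetP/eqP => [[z]|->].
  rewrite inE prefixE take_oversize ?size_map // => /eqP/eq_in_map zx ->.
  by rewrite -Fv; congr (F v _); apply/ffunP=> u; apply: zx.
by exists x; rewrite // inE prefix_refl.
Qed.

Lemma mu_mono (T : finType) (e : rel T) (B B' : Defs.family T) :
  (forall K v (f : strategy T K), B K v f -> B' K v f) -> mu e B <= mu e B'.
Proof.
move=> BB'; apply/bigmax_leqP => K /existsP[F /andP[/forallP FB winF]].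
apply: (@leq_bigmax_cond _ _ (@nat_of_ord _)); apply/existsP; exists F.
rewrite winF andbT; apply/forallP=> v.
by have /andP[-> /BB'] := FB v.
Qed.

Theorem theorem9 (T : finType) (e : rel T)
    (e_sym : symmetric e) (e_irr : irreflexive e) :
  mu e (@bipolar T) <= col e /\ mu e (@open_bipolar T) <= col e.
Proof.
(* The larger family comes first: its bound passes to [bipolar] by monotonicity of [mu]. *)
have open_le : mu e (@open_bipolar T) <= col e.
  apply/bigmax_leqP => K /existsP[F /andP[/forallP FB winF]].
  rewrite leqNgt; apply: contraL winF => ltK.
  have colP : col_order e (col e) by rewrite /col; case: ex_minnP.
  by apply: open_bipolar_not_winning colP ltK _ _ => // v; case/andP: (FB v).
split=> //; apply: leq_trans open_le.
by apply: mu_mono => K v f; apply: bipolar_open.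
Qed.
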